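(* Let $X\subset\mathbb{R}^n$ be a closed convex semialgebraic set containing at least two points, let $f\in\mathbb{R}[x_1,\ldots,x_n]$, and let $d>\deg f$ be an even integer. Then the following conditions are equivalent: (1) $f$ is nonnegative on $X$; (2) for any $a,b>0$ there exists $N_0\in\mathbb{N}$ such that for any integer $N\ge N_0$ the polynomial $\varphi_N(x)=(1+|x|^2)^N\bigl(f(x)+a|x|^d+b\bigr)$ is a strongly convex function on $X$.
   Context: $|x|^2=x_1^2+\cdots+x_n^2$. A function $\varphi$ is strongly convex on a convex set $X$ if there is $\mu>0$ such that $\varphi(x)-\frac{\mu}{2}|x|^2$ is convex on $X$. *)

(* Defs.v *)
From mathcomp Require Export all_boot all_order all_algebra.
From mathcomp Require Export all_classical all_reals all_analysis.
(* The notations of mpoly clash with those of mathcomp-analysis *)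
From mathcomp Require Export -(notations) mpoly.

Set Implicit Arguments.
Unset Strict Implicit.
Unset Printing Implicit Defensive.

Import Order.TTheory GRing.Theory Num.Theory.
Import numFieldNormedType.Exports.

Local Open Scope classical_set_scope.
Local Open Scope ring_scope.

Notation mpolyT R n := (mpoly n R).

Section defs.
Context {R : realType} {n : nat}.
Implicit Types (x : 'rV[R]_n) (X : set 'rV[R]_n).

Definition peval (p : mpolyT R n) x : R :=
  meval (fun i => x ord0 i) p.

(* The norm that mathcomp-analysis puts on 'rV[R]_n is the sup norm. *)
Definition enorm x : R := Num.sqrt (\sum_(i < n) x ord0 i ^+ 2).

(* Finite unions of sets {p_1 = ... = p_k = 0, q_1 > 0, ..., q_l > 0}; each
   item of s is the pair of the list of the p_i and the list of the q_j. *)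
Definition semialgebraic X : Prop :=
  exists s : seq (seq (mpolyT R n) * seq (mpolyT R n)),
    X = [set x | has (fun c => all (fun p => peval p x == 0) c.1 &&
                               all (fun q => 0 < peval q x) c.2) s].

Definition strongly_convex X (phi : 'rV[R]_n -> R) : Prop :=
  exists2 mu : R, 0 < mu &
    convex_function X (fun x => phi x - mu / 2 * enorm x ^+ 2).

(* mmeasure mdeg p (msize p in the library) is 1 + deg p, and 0 for p = 0, so that
   deg 0 = -oo. *)
Definition deg_lt (p : mpolyT R n) (d : nat) : bool :=
  (mmeasure mdeg p <= d)%N.

End defs.

(* Main.v *)
(* Write g = f + a|x|^d + b, r = 1 + |x|^2 and rho = r^(1/2).
   If f >= 0 on X, then g >= c rho^d on X, while along any line of direction v
   the first and second derivatives of g are O(rho^(d-1) |v|) and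
   O(rho^(d-2) |v|^2). Expanding (r^N g)'', the terms
   r^(N-2) (4 N (N-1) <x,v>^2 + 2 N r |v|^2) g dominate the others for N large,
   so that (r^N g)'' >= c |v|^2 on X.
   Conversely, if f < 0 somewhere on X, then g < 0 on some segment of X for
   small a and b. Since r is strictly convex, at one endpoint it is larger than
   at the midpoint, so there r^N g is exponentially more negative than at the
   midpoint, which contradicts convexity. *)

Require Import Defs.
From mathcomp Require Import all_boot all_order all_algebra.
From mathcomp Require Import all_classical all_reals all_analysis.
From mathcomp Require Import ring lra.
From mathcomp Require polyrcf.
Import Order.TTheory GRing.Theory Num.Theory.
Import numFieldNormedType.Exports.

Local Open Scope classical_set_scope.
Local Open Scope ring_scope.

Section Perturbation.
Set Implicit Arguments.
Unset Strict Implicit.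
Context {R : realType} {n : nat}.
Implicit Types (x v y : 'rV[R]_n) (p q : mpolyT R n).

(** * Restriction of polynomials to lines *)

(** Three uses of the mean value theorem: the convexity gap at [t] is t(1-t)(P'(c2) - P'(c1)) with
    c1 < t < c2, and P'(c2) - P'(c1) = P''(c3)(c2 - c1). *)
Lemma poly_convex01 (P : {poly R}) (t : R) :
  (forall c, 0 <= c <= 1 -> 0 <= P^`()^`().[c]) -> 0 <= t <= 1 ->
  P.[t] <= t * P.[1] + (1 - t) * P.[0].
Proof.
move=> P2 /andP[]; rewrite le_eqVlt => /predU1P[<- _|t0]; first by lra.
rewrite le_eqVlt => /predU1P[->|t1]; first by lra.
have [c1] := polyrcf.poly_mvt P t0; rewrite in_itv /= subr0 => /andP[c10 c1t] E1.
have [c2] := polyrcf.poly_mvt P t1; rewrite in_itv /= => /andP[c2t c21] E2.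
have [c3] := polyrcf.poly_mvt P^`() (lt_trans c1t c2t).
rewrite in_itv /= => /andP[c31 c32] E3.
have H3 : 0 <= P^`()^`().[c3] by apply: P2; lra.
have : 0 <= P^`()^`().[c3] * (c2 - c1) by apply: mulr_ge0 => //; lra.
rewrite -E3 => H4.
have : 0 <= t * (1 - t) * (P^`().[c2] - P^`().[c1]).
  by apply: mulr_ge0 => //; apply: mulr_ge0; lra.
nra.
Qed.

(** Substituting into a univariate polynomial makes directional derivatives formal ones, and makes
    the restriction compatible with sums and products. *)
Definition line x v p : {poly R} :=
  mmap (@polyC R) (fun i => (x ord0 i)%:P + (v ord0 i)%:P * 'X) p.

Lemma horner_line x v p t : (line x v p).[t] = peval p (x + t *: v).
Proof.
rewrite /line /mmap /peval mevalE horner_sum; apply: eq_bigr => m _.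
rewrite hornerM hornerC /mmap1 horner_prod; congr (_ * _).
apply: eq_bigr => i _; rewrite horner_exp.
by rewrite !(hornerD, hornerM, hornerC, hornerX) !mxE mulrC.
Qed.

Definition sqn : mpolyT R n := \sum_(i < n) mpolyX R (mnm1 i) ^+ 2.

Lemma enormE x : enorm x ^+ 2 = \sum_(i < n) x ord0 i ^+ 2.
Proof. by rewrite sqr_sqrtr // sumr_ge0 // => i _; rewrite sqr_ge0. Qed.

Lemma peval_sqn x : peval sqn x = enorm x ^+ 2.
Proof.
rewrite enormE /peval /sqn raddf_sum /=; apply: eq_bigr => i _.
by rewrite rmorphXn /= mevalXU.
Qed.

Lemma line_coord x v i :
  line x v (mpolyX R (mnm1 i)) = (x ord0 i)%:P + (v ord0 i)%:P * 'X.
Proof. by rewrite /line mmapX mmap1U. Qed.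

Lemma line_sqn x v :
  line x v sqn = \sum_(i < n) ((x ord0 i)%:P + (v ord0 i)%:P * 'X) ^+ 2.
Proof.
rewrite /line /sqn raddf_sum; apply: eq_bigr => i _ /=.
by rewrite rmorphXn /= -/(line x v _) line_coord.
Qed.

Lemma deriv_coord (a b : R) : (a%:P + b%:P * 'X)^`() = b%:P.
Proof. by rewrite derivD derivM !derivC derivX mul0r !add0r mulr1. Qed.

Lemma horner_deriv_sqn x v t :
  (line x v sqn)^`().[t] = 2 * \sum_(i < n) (x + t *: v) ord0 i * v ord0 i.
Proof.
rewrite line_sqn raddf_sum horner_sum mulr_sumr; apply: eq_bigr => i _ /=.
by rewrite expr2 derivM deriv_coord !(hornerD, hornerM, hornerC, hornerX) !mxE; ring.
Qed.

Lemma horner_deriv2_sqn x v t :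
  (line x v sqn)^`()^`().[t] = 2 * enorm v ^+ 2.
Proof.
rewrite line_sqn !raddf_sum horner_sum enormE mulr_sumr.
apply: eq_bigr => i _ /=.
rewrite expr2 derivM deriv_coord derivD !derivM deriv_coord !derivC.
by rewrite !(hornerD, hornerM, hornerC, hornerX); ring.
Qed.

(** * The Japanese bracket and symbol estimates *)

Definition bracket x : R := Num.sqrt (1 + enorm x ^+ 2).

Lemma sqr_bracket x : bracket x ^+ 2 = 1 + enorm x ^+ 2.
Proof. by rewrite sqr_sqrtr // addr_ge0 // sqr_ge0. Qed.

Lemma bracket_ge1 x : 1 <= bracket x.
Proof. by rewrite -[leLHS]sqrtr1 ler_wsqrtr // lerDl sqr_ge0. Qed.

Lemma enorm_ge0 x : 0 <= enorm x. Proof. exact: sqrtr_ge0. Qed.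

Lemma coord_le_enorm x i : `|x ord0 i| <= enorm x.
Proof.
rewrite -sqrtr_sqr ler_wsqrtr // (bigD1 i) //= lerDl.
by rewrite sumr_ge0 // => j _; rewrite sqr_ge0.
Qed.

Lemma enorm_le_bracket x : enorm x <= bracket x.
Proof.
by rewrite -[leLHS]ger0_norm ?enorm_ge0 // -sqrtr_sqr ler_wsqrtr // lerDr.
Qed.

(* The estimates of Hormander's symbol class S^k for two derivatives: each
   derivative in a direction v costs |v| and gains a factor 1 / bracket. *)
Definition symbol (k : nat) p := exists2 C : R, 0 <= C &
  forall x v t (y := x + t *: v) (P := line x v p),
  [/\ `|P.[t]| <= C * bracket y ^+ k,
      bracket y * `|P^`().[t]| <= C * bracket y ^+ k * enorm v &
      bracket y ^+ 2 * `|P^`()^`().[t]| <= C * bracket y ^+ k * enorm v ^+ 2].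

Lemma symbolW k l p : (k <= l)%N -> symbol k p -> symbol l p.
Proof.
move=> kl [C C0 H]; exists C => // x v t y P; have [H0 H1 H2] := H x v t.
have le : C * bracket y ^+ k <= C * bracket y ^+ l.
  by rewrite ler_wpM2l // ler_weXn2l // bracket_ge1.
split; first exact: le_trans le.
  by apply: le_trans H1 _; rewrite ler_wpM2r // enorm_ge0.
by apply: le_trans H2 _; rewrite ler_wpM2r // sqr_ge0.
Qed.

Lemma symbolC k (c : R) : symbol k (mpolyC n c).
Proof.
exists `|c| => // x v t y P; have -> : P = c%:P by rewrite /P /line mmapC.
rewrite !derivC !(hornerD, hornerM, hornerC, hornerX) normr0 !mulr0.
have b0 : 0 <= bracket y by rewrite sqrtr_ge0.
split; rewrite ?mulr_ge0 ?exprn_ge0 ?enorm_ge0 //.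
by rewrite ler_peMr // exprn_ege1 // bracket_ge1.
Qed.

Lemma symbolD k p q : symbol k p -> symbol k q -> symbol k (p + q).
Proof.
move=> [C C0 H] [D D0 G]; exists (C + D); first exact: addr_ge0.
move=> x v t y P; have [H0 H1 H2] := H x v t; have [G0 G1 G2] := G x v t.
have -> : P = line x v p + line x v q by rewrite /P /line mmapD.
rewrite !derivD !hornerD; split.
- by rewrite mulrDl (le_trans (ler_normD _ _)) // lerD.
- rewrite !mulrDl (le_trans _ (lerD H1 G1)) // -mulrDr ler_wpM2l ?ler_normD //.
  by rewrite sqrtr_ge0.
- rewrite !mulrDl (le_trans _ (lerD H2 G2)) // -mulrDr ler_wpM2l ?ler_normD //.
  by rewrite sqr_ge0.
Qed.

Lemma ler_pM_norm (a b c d : R) : `|a| <= c -> `|b| <= d -> `|a * b| <= c * d.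
Proof. by move=> ac bd; rewrite normrM ler_pM. Qed.

(** Leibniz rule: the second derivative of a product consists of 1 + 2 + 1 terms, each contributing
    [C * D], whence the constant 4. *)
Lemma symbolM k l p q : symbol k p -> symbol l q -> symbol (k + l) (p * q).
Proof.
move=> [C C0 H] [D D0 G]; exists (4 * (C * D)).
  by rewrite !mulr_ge0.
move=> x v t y P; have [H0 H1 H2] := H x v t; have [G0 G1 G2] := G x v t.
have -> : P = line x v p * line x v q by rewrite /P /line rmorphM.
rewrite derivM derivD !derivM !(hornerD, hornerM, hornerC, hornerX) exprD.
move: H0 H1 H2 G0 G1 G2; rewrite -/y.
set p0 := _.[t]; set p1 := _.[t]; set p2 := _.[t].
set q0 := _.[t]; set q1 := _.[t]; set q2 := _.[t].
have b0 : 0 <= bracket y by rewrite sqrtr_ge0.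
have bk : 0 <= C * bracket y ^+ k by rewrite mulr_ge0 ?exprn_ge0.
have bl : 0 <= D * bracket y ^+ l by rewrite mulr_ge0 ?exprn_ge0.
have w0 := enorm_ge0 v.
have nb (m : nat) (z : R) : bracket y ^+ m * `|z| = `|bracket y ^+ m * z|.
  by rewrite normrM ger0_norm ?exprn_ge0.
have := nb 1%N; rewrite expr1 => nb1.
rewrite !nb1 !nb => H0 H1 H2 G0 G1 G2.
have E : 0 <= C * bracket y ^+ k * (D * bracket y ^+ l) by rewrite mulr_ge0.
set A := C * bracket y ^+ k in bk H0 H1 H2 E *.
set B := D * bracket y ^+ l in bl G0 G1 G2 E *.
have -> : 4 * (C * D) * (bracket y ^+ k * bracket y ^+ l) = 4 * (A * B).
  by rewrite /A /B; ring.
split.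
- by apply: le_trans (ler_pM_norm H0 G0) _; lra.
- have -> : bracket y * (p1 * q0 + p0 * q1) =
    (bracket y * p1) * q0 + p0 * (bracket y * q1) by ring.
  apply: le_trans (ler_normD _ _) _.
  apply: le_trans (lerD (ler_pM_norm H1 G0) (ler_pM_norm H0 G1)) _.
  have := mulr_ge0 E w0; lra.
- have -> : bracket y ^+ 2 * (p2 * q0 + p1 * q1 + (p1 * q1 + p0 * q2)) =
    ((bracket y ^+ 2 * p2) * q0 + (bracket y * p1) * (bracket y * q1)) +
    ((bracket y * p1) * (bracket y * q1) + p0 * (bracket y ^+ 2 * q2)) by ring.
  apply: le_trans (ler_normD _ _) _.
  apply: le_trans (lerD (ler_normD _ _) (ler_normD _ _)) _.
  apply: le_trans (lerD (lerD (ler_pM_norm H2 G0) (ler_pM_norm H1 G1))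
                        (lerD (ler_pM_norm H1 G1) (ler_pM_norm H0 G2))) _.
  have := mulr_ge0 E (sqr_ge0 (enorm v)); lra.
Qed.

Lemma symbolXn k p m : symbol k p -> symbol (k * m) (p ^+ m).
Proof.
move=> kp; elim: m => [|m IHm]; first by rewrite expr0 -mpolyC1; exact: symbolC.
by rewrite exprS mulnS; exact: symbolM.
Qed.

Lemma symbol_coord i : symbol 1 (mpolyX R (mnm1 i)).
Proof.
exists 1 => // x v t y P; have -> : P = (x ord0 i)%:P + (v ord0 i)%:P * 'X.
  exact: line_coord.
rewrite deriv_coord derivC expr1 !mul1r.
rewrite !(hornerD, hornerM, hornerC, hornerX) normr0 mulr0.
have b0 : 0 <= bracket y by rewrite sqrtr_ge0.
split.
- have -> : x ord0 i + v ord0 i * t = y ord0 i by rewrite /y !mxE mulrC.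
  exact: le_trans (coord_le_enorm _ _) (enorm_le_bracket _).
- by rewrite ler_wpM2l // coord_le_enorm.
- by rewrite mulr_ge0 // sqr_ge0.
Qed.

Lemma symbol_sum k (I : Type) (r : seq I) (F : I -> mpolyT R n) :
  (forall i, symbol k (F i)) -> symbol k (\sum_(i <- r) F i).
Proof.
move=> FP; elim/big_ind: _ => //; last exact: symbolD.
by rewrite -mpolyC0; exact: symbolC.
Qed.

Lemma symbol_mpolyX (m : multinom n) : symbol (mdeg m) (mpolyX R m).
Proof.
rewrite mpolyXE_id mdegE.
elim/big_rec2: _ => [|i p k _ IH].
  by rewrite -mpolyC1; exact: symbolC.
apply: symbolM IH; rewrite -[k in symbol k _]mul1n.
exact/symbolXn/symbol_coord.
Qed.

(** Coordinates have order 1 and orders add under products, so each monomial has its degree as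
    order; [symbolW] raises these orders to [d]. *)
Lemma deg_lt_symbol p d : deg_lt p d -> symbol d p.
Proof.
move=> pd; rewrite [p]mpolyE big_seq; elim/big_ind: _; last first.
- move=> m mp; apply: (symbolW (k := mdeg m)).
    exact/ltnW/(leq_trans (mmeasure_mnm_lt _ mp)).
  rewrite -mul_mpolyC; apply: (symbolM (k := 0)); last exact: symbol_mpolyX.
  exact: symbolC.
- by move=> *; exact: symbolD.
- by rewrite -mpolyC0; exact: symbolC.
Qed.

Lemma symbol_sqn : symbol 2 sqn.
Proof.
by apply: symbol_sum => i; apply: (symbolXn (k := 1)); exact: symbol_coord.
Qed.

(** * Strong convexity from a lower bound of full order *)

(** The exponent is written [m.+2] so that the power N - 2 factors out without truncated
    subtraction; the cofactor is what [bracket_estimate] bounds below. *)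
Lemma horner_deriv2_expM (P Q : {poly R}) m t :
  (P ^+ m.+2 * Q)^`()^`().[t] = P.[t] ^+ m *
    (m.+2%:R * m.+1%:R * P^`().[t] ^+ 2 * Q.[t]
     + m.+2%:R * P.[t] * P^`()^`().[t] * Q.[t]
     + 2 * m.+2%:R * P.[t] * P^`().[t] * Q^`().[t]
     + P.[t] ^+ 2 * Q^`()^`().[t]).
Proof.
have dX k : (P ^+ k.+1)^`() = k.+1%:R *: (P^`() * P ^+ k).
  by rewrite deriv_exp scaler_nat.
have dMM (A : {poly R}) :
    (A * Q)^`()^`() = A^`()^`() * Q + 2%:R *: (A^`() * Q^`()) + A * Q^`()^`().
  rewrite derivM derivD !derivM scaler_nat mulr2n !addrA.
  by congr (_ + _).
rewrite dMM !(dX m.+1) derivZ derivM (dX m).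
rewrite !(horner_exp, hornerD, hornerM, hornerZ) (exprS _ m.+1) (exprS _ m).
by ring.
Qed.

(* Completing the square: b^2 w^2 + 4 K^2 s^2 >= 4 b K |s| w absorbs the
   cross term. *)
Lemma bracket_estimate (b s w g g1 g2 K m : R) :
  0 <= b -> 0 <= w -> 0 <= g -> 0 <= K ->
  b * `|g1| <= K * g * w -> b ^+ 2 * `|g2| <= K * g * w ^+ 2 ->
  K ^+ 2 + 1 <= m -> K + 1 <= m ->
  g * w ^+ 2 * b ^+ 2 <= m * (m - 1) * (2 * s) ^+ 2 * g
    + m * b ^+ 2 * (2 * w ^+ 2) * g + 2 * m * b ^+ 2 * (2 * s) * g1
    + (b ^+ 2) ^+ 2 * g2.
Proof.
move=> b0 w0 g0 K0 H1 H2 mK2 mK.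
have m0 : 0 <= m by apply: le_trans mK; lra.
have H3 : - (4 * m * g * (b * `|s| * K * w)) <= 2 * m * b ^+ 2 * (2 * s) * g1.
  have -> : 2 * m * b ^+ 2 * (2 * s) * g1 = 4 * m * (b * s * (b * g1)) by ring.
  have : `|b * s * (b * g1)| <= b * `|s| * (K * g * w).
    by rewrite normrM ler_pM // normrM (ger0_norm b0).
  rewrite ler_norml => /andP[+ _] => /(ler_wpM2l (mulr_ge0 (ler0n _ 4) m0)).
  by apply: le_trans; rewrite le_eqVlt; apply/orP; left; apply/eqP; ring.
have H4 : - (b ^+ 2 * (K * g * w ^+ 2)) <= (b ^+ 2) ^+ 2 * g2.
  have -> : (b ^+ 2) ^+ 2 * g2 = b ^+ 2 * (b ^+ 2 * g2) by ring.
  have : `|b ^+ 2 * g2| <= K * g * w ^+ 2 by rewrite normrM ger0_norm ?sqr_ge0.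
  rewrite ler_norml => /andP[+ _] => /(ler_wpM2l (sqr_ge0 b)).
  by apply: le_trans; rewrite mulrN.
have mg : 0 <= m * g by rewrite mulr_ge0.
(* The square uses up 4 m K^2 s^2 g and m b^2 w^2 g of the two main terms. By [H6] the rest of the
   first is nonnegative; by [H7] the rest of the second pays for the bound K g b^2 w^2 of [H4] and
   leaves g b^2 w^2. *)
have H5 : 0 <= m * g * (b * w - 2 * K * `|s|) ^+ 2.
  by apply: mulr_ge0 => //; exact: sqr_ge0.
have H6 : 0 <= m * g * (2 * s) ^+ 2 * (m - 1 - K ^+ 2).
  by apply: mulr_ge0; [apply: mulr_ge0 => //; exact: sqr_ge0|lra].
have H7 : 0 <= g * (b * w) ^+ 2 * (m - K - 1).
  by apply: mulr_ge0; [apply: mulr_ge0 => //; exact: sqr_ge0|lra].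
have E : `|s| ^+ 2 = s ^+ 2 by rewrite real_normK ?num_real.
have H8 : m * g * (b * w - 2 * K * `|s|) ^+ 2 =
  m * g * (b ^+ 2 * w ^+ 2 + 4 * K ^+ 2 * s ^+ 2) -
  4 * m * g * (b * `|s| * K * w) by rewrite -E; ring.
rewrite H8 in H5; lra.
Qed.

(** The lower bound has the same order as the symbol, so the derivatives of [p] are controlled by
    [p] itself on [X], with the ratio C / c as constant. *)
Lemma strongly_convex_symbol (X : set 'rV[R]_n) d p (c : R) :
  convex_set X -> symbol d p -> 0 < c ->
  (forall x, X x -> c * bracket x ^+ d <= peval p x) ->
  exists N0 : nat, forall N : nat, (N0 <= N)%N ->
    strongly_convex X (fun x => (1 + enorm x ^+ 2) ^+ N * peval p x).
Proof.
move=> cX [C C0 Hp] c0 low.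
pose K := C / c.
have K0 : 0 <= K by rewrite divr_ge0 // ltW.
have K20 : 0 <= K ^+ 2 by rewrite sqr_ge0.
(* This threshold puts N above both K^2 + 1 and K + 1, and makes it of the form [m.+2]. The modulus
   of strong convexity is [c], for every such N. *)
exists (Num.bound (K + K ^+ 2)).+2 => N NK; exists c => // t x y.
rewrite !inE => Xx Xy.
have [m Nm] : exists m, N = m.+2.
  by case: N NK => [|[|m]] // _; exists m.
have Km : K + K ^+ 2 + 1 <= m.+2%:R.
  have : K + K ^+ 2 < (Num.bound (K + K ^+ 2))%:R by rewrite archi_boundP ?addr_ge0.
  move: NK; rewrite Nm !ltnS -(ler_nat R) => NK.
  by rewrite -natr1 -natr1; lra.
pose v := x - y.
(* The function to be shown convex, restricted to the line that is at [y] for parameter 0 and at [x]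
   for parameter 1. *)
pose Q := (1 + line y v sqn) ^+ N * line y v p - (c / 2) *: line y v sqn.
have QE s : Q.[s] = (1 + enorm (y + s *: v) ^+ 2) ^+ N * peval p (y + s *: v) -
    c / 2 * enorm (y + s *: v) ^+ 2.
  rewrite /Q hornerD hornerN hornerM hornerZ horner_exp hornerD hornerC !horner_line.
  by rewrite peval_sqn.
have t01 : 0 <= t%:num <= 1 by apply/andP; split.
have segE s : y + s *: v = s *: x + (1 - s) *: y.
  by rewrite /v scalerBr scalerBl scale1r addrCA.
have := fun H => poly_convex01 (P := Q) H t01; rewrite !QE.
rewrite scale0r addr0 (_ : y + 1 *: v = x) ?segE; last first.
  by rewrite scale1r subrr scale0r addr0.
apply.
move=> s s01.
have Xs : X (y + s *: v).
  have [s0 s1] := andP s01.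
  have := cX x y (@Itv01 R s s0 s1); rewrite !inE => /(_ Xx Xy).
  by rewrite segE.
have [H0 H1 H2] := Hp y v s.
have G := low _ Xs.
rewrite /Q !derivB !derivZ hornerD hornerN hornerZ horner_deriv2_sqn Nm.
rewrite horner_deriv2_expM !derivD !derivC !add0r hornerD hornerC horner_line.
rewrite peval_sqn -sqr_bracket horner_deriv2_sqn horner_deriv_sqn horner_line.
set z := y + s *: v in Xs G H0 H1 H2 *.
set g := peval p z in G *; set g1 := _^`().[s] in H1 *.
set g2 := _^`()^`().[s] in H2 *.
have b1 := bracket_ge1 z.
have b0 : 0 <= bracket z by lra.
have w0 := enorm_ge0 v.
have cg : c <= g.
  by apply: le_trans G; rewrite ler_peMr ?exprn_ege1 // ltW.
have CK : C * bracket z ^+ d <= K * g.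
  by rewrite -(divfK (lt0r_neq0 c0) C) -/K -mulrA ler_wpM2l.
have F1 : bracket z * `|g1| <= K * g * enorm v.
  by apply: le_trans H1 _; rewrite ler_wpM2r.
have F2 : bracket z ^+ 2 * `|g2| <= K * g * enorm v ^+ 2.
  by apply: le_trans H2 _; rewrite ler_wpM2r ?sqr_ge0.
have g0 : 0 <= g by lra.
have mK2 : K ^+ 2 + 1 <= m.+2%:R by lra.
have mK : K + 1 <= m.+2%:R by lra.
have := bracket_estimate (\sum_(i < n) z ord0 i * v ord0 i) b0 w0 g0 K0 F1 F2
  mK2 mK.
have -> : m.+2%:R - 1 = m.+1%:R :> R by rewrite -natr1 addrK.
set B := (X in _ <= X) => HB.
have r1 : 1 <= bracket z ^+ 2 by rewrite exprn_ege1.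
(* The left side is the second derivative of (c/2)|.|^2 along the line; the bound follows from g >=
   c and r >= 1. *)
have cw : c * enorm v ^+ 2 <= B.
  apply: le_trans HB; apply: le_trans (_ : g * enorm v ^+ 2 <= _).
    by rewrite ler_wpM2r ?sqr_ge0.
  by rewrite ler_peMr // mulr_ge0 ?sqr_ge0 //; lra.
have B0 : 0 <= B by apply: le_trans cw; rewrite mulr_ge0 ?sqr_ge0 // ltW.
have BM : B <= (bracket z ^+ 2) ^+ m * B by rewrite ler_peMl // exprn_ege1.
rewrite subr_ge0; apply: le_trans (le_trans cw BM).
by rewrite mulrA divfK.
Qed.

(** * From nonnegativity to strong convexity *)

(** With s = |x|^2, (1 + s)^k <= (2 max(1, s))^k <= 2^k (1 + s^k). *)
Lemma bracket_even_le x k :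
  bracket x ^+ k.*2 <= 2 ^+ k * (1 + enorm x ^+ k.*2).
Proof.
rewrite -!mul2n !exprM sqr_bracket; set s := enorm x ^+ 2.
have s0 : 0 <= s by rewrite sqr_ge0.
have sk : 0 <= s ^+ k by rewrite exprn_ge0.
have k0 : 0 <= 2 ^+ k :> R by rewrite exprn_ge0.
have [s1|s1] := leP s 1.
  apply: le_trans (_ : 2 ^+ k <= _); first by rewrite lerXn2r ?nnegrE; lra.
  by rewrite ler_peMr // lerDl.
apply: le_trans (_ : (2 * s) ^+ k <= _); first by rewrite lerXn2r ?nnegrE; lra.
by rewrite exprMn ler_wpM2l // lerDr.
Qed.

(** Evenness of d = 2k is what makes |x|^d a polynomial, the k-th power of [sqn]. *)
Definition perturb p (a b : R) k := p + mpolyC n a * sqn ^+ k + mpolyC n b.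

Lemma peval_perturb p a b k x :
  peval (perturb p a b k) x = peval p x + a * enorm x ^+ k.*2 + b.
Proof.
rewrite /peval /perturb !mevalD mevalM !mevalC rmorphXn /= -!/(peval _ x).
by rewrite peval_sqn -exprM mul2n.
Qed.

Lemma nonneg_strongly_convex (X : set 'rV[R]_n) p d (a b : R) :
  convex_set X -> deg_lt p d -> ~~ odd d -> 0 < a -> 0 < b ->
  (forall x, X x -> 0 <= peval p x) ->
  exists N0 : nat, forall N : nat, (N0 <= N)%N ->
    strongly_convex X (fun x =>
      (1 + enorm x ^+ 2) ^+ N * (peval p x + a * enorm x ^+ d + b)).
Proof.
move=> cX pd dE a0 b0 pX.
have dk : d = (d./2).*2 by rewrite -[LHS]odd_double_half (negbTE dE).
set k := d./2 in dk.
pose q := perturb p a b k.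
have qE x : peval q x = peval p x + a * enorm x ^+ d + b.
  by rewrite peval_perturb -dk.
have sq : symbol d q.
  apply: symbolD; last exact: symbolC.
  apply: symbolD; first exact: deg_lt_symbol.
  apply: (symbolM (k := 0)); first exact: symbolC.
  by rewrite dk -mul2n; apply: symbolXn; exact: symbol_sqn.
(* Since f >= 0, g >= min(a, b)(1 + |x|^d), and [bracket_even_le] costs the factor 2^k. *)
pose c := Num.min a b / 2 ^+ k.
have m0 : 0 < Num.min a b by rewrite lt_min a0.
have k0 : 0 < 2 ^+ k :> R by rewrite exprn_gt0.
have [|x Xx|N0 HN] := strongly_convex_symbol (c := c) cX sq.
- by rewrite divr_gt0.
- rewrite qE; apply: le_trans (_ : Num.min a b * (1 + enorm x ^+ d) <= _).
    rewrite /c -mulrA ler_wpM2l ?(ltW m0) //.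
    rewrite ler_pdivrMl // [in X in X <= _]dk [in X in _ <= X]dk.
    exact: bracket_even_le.
  have e0 : 0 <= enorm x ^+ d by rewrite exprn_ge0 ?enorm_ge0.
  have : Num.min a b * enorm x ^+ d <= a * enorm x ^+ d.
    by rewrite ler_wpM2r // ge_min lexx.
  have : Num.min a b <= b by rewrite ge_min lexx orbT.
  by have := pX _ Xx; lra.
exists N0 => N NN; have [mu mu0 H] := HN N NN; exists mu => // t x y Xx Xy.
by have := H t x y Xx Xy; rewrite !qE.
Qed.

(** * From strong convexity to nonnegativity *)

Lemma power_unbounded (q c : R) : 1 < q -> exists N0 : nat,
  forall N : nat, (N0 <= N)%N -> c < q ^+ N.
Proof.
move=> q1; have q0 : 0 < q - 1 by lra.
exists (Num.bound (`|c| / (q - 1))) => N NN.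
have bernoulli m : m%:R * (q - 1) < q ^+ m.
  elim: m => [|m IH]; first by rewrite mul0r expr0.
  have : 1 <= q ^+ m by rewrite exprn_ege1 // ltW.
  by rewrite exprS -natr1; nra.
apply: le_lt_trans (ler_norm c) _; apply: lt_trans (bernoulli N).
rewrite -ltr_pdivrMr //; apply: lt_le_trans (archi_boundP _) _.
  by rewrite divr_ge0 // ltW.
by rewrite ler_nat.
Qed.

(* Otherwise h(1/2) <= (h(0) + h(1)) / 2 <= h(1) / 2 for h = (1 + |x|^2)^N g
   along the segment, although (1 + |x|^2)^N is exponentially larger at x than
   at the midpoint. *)
Lemma midpoint_not_strongly_convex (X : set 'rV[R]_n) (g : 'rV[R]_n -> R) x y :
  X x -> X y -> g x < 0 -> g y <= 0 -> enorm y <= enorm x -> x != y ->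
  (exists N0 : nat, forall N : nat, (N0 <= N)%N ->
    strongly_convex X (fun z => (1 + enorm z ^+ 2) ^+ N * g z)) -> False.
Proof.
move=> Xx Xy gx gy yx xy [N0 HN].
pose z := 2^-1 *: x + (1 - 2^-1) *: y.
(* As |y| <= |x| and x differs from y, this identity forces |z| < |x|, hence a ratio [rx / rz] above
   1. It also gives the sign of the [mu] terms in [F3]. *)
have parallelogram : enorm z ^+ 2 + enorm (x - y) ^+ 2 / 4 =
    enorm x ^+ 2 / 2 + enorm y ^+ 2 / 2.
  rewrite !enormE !mulr_suml -!big_split; apply: eq_bigr => i _ /=.
  by rewrite !mxE; field.
have d0 : 0 < enorm (x - y) ^+ 2.
  rewrite lt_neqAle sqr_ge0 andbT eq_sym; apply: contra xy => /eqP d0.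
  apply/eqP/rowP => i; apply/eqP; rewrite -subr_eq0 -normr_le0.
  have := coord_le_enorm (x - y) i; rewrite !mxE.
  by move/eqP: d0; rewrite sqrf_eq0 => /eqP ->.
have yx2 : enorm y ^+ 2 <= enorm x ^+ 2.
  by rewrite ler_pXn2r // nnegrE enorm_ge0.
have ry0 := sqr_ge0 (enorm y); have rz0 := sqr_ge0 (enorm z).
set rx := 1 + enorm x ^+ 2; set rz := 1 + enorm z ^+ 2.
have rz1 : 0 < rz by rewrite /rz; lra.
have q1 : 1 < rx / rz by rewrite ltr_pdivlMr // mul1r /rx /rz; lra.
(* For this constant, rx^N g(x) / 2 < - rz^N |g(z)| <= rz^N g(z), the opposite of [F3]. *)
have [N1 HN1] := power_unbounded (2 * `|g z| / - g x) q1.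
have [mu mu0 cvx] := HN (maxn N0 N1) (leq_maxl _ _).
have /(_ (leq_maxr _ _)) big := HN1 (maxn N0 N1).
set N := maxn N0 N1 in cvx big.
have h01 : (0 : R) <= 2^-1 by lra.
have h11 : (2^-1 : R) <= 1 by lra.
have := cvx (Itv01 h01 h11) x y; rewrite !inE => /(_ Xx Xy).
change (rz ^+ N * g z - mu / 2 * enorm z ^+ 2 <=
  2^-1 * (rx ^+ N * g x - mu / 2 * enorm x ^+ 2) +
  (1 - 2^-1) * ((1 + enorm y ^+ 2) ^+ N * g y - mu / 2 * enorm y ^+ 2) -> False).
move=> H.
have F1 : (1 + enorm y ^+ 2) ^+ N * g y <= 0.
  by apply: mulr_ge0_le0 => //; apply: exprn_ge0; lra.
have F2 : 0 <= mu / 2 * (enorm (x - y) ^+ 2 / 4).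
  by apply: mulr_ge0; lra.
have F3 : rz ^+ N * g z <= 2^-1 * (rx ^+ N * g x).
  have : mu / 2 * (enorm z ^+ 2 + enorm (x - y) ^+ 2 / 4) =
    mu / 2 * (enorm x ^+ 2 / 2 + enorm y ^+ 2 / 2) by rewrite parallelogram.
  lra.
have rzN : 0 < rz ^+ N by rewrite exprn_gt0.
move: big; rewrite expr_div_n ltr_pdivlMr // mulrAC ltr_pdivrMr ?oppr_gt0 //.
have : - g z * rz ^+ N <= `|g z| * rz ^+ N.
  by rewrite ler_wpM2r ?(ltW rzN) // -normrN ler_norm.
lra.
Qed.

Lemma strongly_convex_nonneg (X : set 'rV[R]_n) p d :
  convex_set X -> ~~ odd d -> (exists x y, [/\ X x, X y & x <> y]) ->
  (forall a b : R, 0 < a -> 0 < b ->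
    exists N0 : nat, forall N : nat, (N0 <= N)%N ->
      strongly_convex X (fun x =>
        (1 + enorm x ^+ 2) ^+ N * (peval p x + a * enorm x ^+ d + b))) ->
  forall x, X x -> 0 <= peval p x.
Proof.
move=> cX dE [u [u' [Xu Xu' uu']]] HX x Xx; rewrite leNgt; apply/negP => px.
have [y Xy xy] : exists2 y, X y & x != y.
  have [xu|xu] := eqVneq x u; last by exists u.
  by exists u' => //; apply/eqP; rewrite xu.
(* With b = e and a|x|^d <= e, g(x) <= f(x) + 2e = f(x)/2 < 0. *)
pose e := - peval p x / 4.
have e0 : 0 < e by rewrite /e; lra.
have dx0 : 0 <= enorm x ^+ d by rewrite exprn_ge0 ?enorm_ge0.
pose a := e / (1 + enorm x ^+ d).
have a0 : 0 < a by rewrite divr_gt0 //; lra.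
have ax : a * enorm x ^+ d <= e.
  by rewrite /a mulrAC ler_pdivrMr; [rewrite ler_pM2l //; lra|lra].
pose g z := peval p z + a * enorm z ^+ d + e.
have gx : g x < 0 by rewrite /g; move: ax; rewrite /e; lra.
have [z [Xz gz xz]] : exists z, [/\ X z, g z < 0 & x != z].
  have dk : d = (d./2).*2 by rewrite -[LHS]odd_double_half (negbTE dE).
  pose P := line x (y - x) (perturb p a e d./2).
  have PE t : P.[t] = g (x + t *: (y - x)).
    by rewrite horner_line peval_perturb -dk.
  have Ngx : 0 < - g x by rewrite oppr_gt0.
  (* Continuity with tolerance -g(x): a small move from [x] towards [y] changes g by less than
     -g(x), so g stays negative. *)
  have [r r0 Pr] := polyrcf.poly_cont 0 P Ngx.
  pose t := Num.min (r / 2) 1.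
  have t0 : 0 < t by rewrite lt_min ltr01 divr_gt0.
  have t1 : t <= 1 by rewrite ge_min lexx orbT.
  have tr : t < r by apply: le_lt_trans (_ : r / 2 < r); [rewrite ge_min lexx|lra].
  exists (x + t *: (y - x)); split.
  - have := cX y x (Itv01 (ltW t0) t1); rewrite !inE => /(_ Xy Xx).
    congr (X _); change (t *: y + (1 - t) *: x = x + t *: (y - x)).
    by rewrite scalerBr scalerBl scale1r addrCA.
  - have := Pr t; rewrite subr0 gtr0_norm // !PE scale0r addr0 => /(_ tr).
    by rewrite ltr_norml => /andP[_]; lra.
  - rewrite eq_sym -subr_eq0 addrAC subrr add0r scaler_eq0 gt_eqF //=.
    by rewrite subr_eq0 eq_sym.
(* The endpoint farther from the origin must come first, so the two points may have to be swapped; g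
   is negative at both. *)
have [zx|/ltW xz'] := leP (enorm z) (enorm x).
  exact: (midpoint_not_strongly_convex Xx Xz gx (ltW gz) zx xz (HX a e a0 e0)).
rewrite eq_sym in xz.
exact: (midpoint_not_strongly_convex Xz Xx gz (ltW gx) xz' xz (HX a e a0 e0)).
Qed.

End Perturbation.

Theorem corollary5p7 (R : realType) (n : nat) (X : set 'rV[R]_n)
  (X_closed : closed X)
  (X_convex : convex_set X)
  (X_semialg : semialgebraic X)
  (X_two_points : exists x y : 'rV[R]_n, [/\ X x, X y & x <> y])
  (f : mpolyT R n) (d : nat) (f_deg : deg_lt f d) (d_even : ~~ odd d) :
  (forall x : 'rV[R]_n, X x -> 0 <= peval f x)
  <->
  (forall a b : R, 0 < a -> 0 < b ->
    exists N0 : nat, forall N : nat, (N0 <= N)%N ->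
      strongly_convex X (fun x : 'rV[R]_n =>
        (1 + enorm x ^+ 2) ^+ N * (peval f x + a * enorm x ^+ d + b))).
Proof.
split=> [fX a b a0 b0|H]; last exact: strongly_convex_nonneg H.
exact: nonneg_strongly_convex.
Qed.
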